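(* Let $\mathbf{A}\in\mathbb{C}^{n\times n}$ with $\operatorname{Ind}\mathbf{A}=k$ and $\operatorname{rank}\mathbf{A}^{k+1}=\operatorname{rank}\mathbf{A}^{k}=r\le n$, where $r\ge1$. Then the Drazin inverse of $\mathbf{A}$ is $$\mathbf{A}^{D}=\left(\frac{d_{ij}}{d_{r}(\mathbf{A}^{k+1})}\right)_{n\times n},$$ where $$d_{r}(\mathbf{A}^{k+1})=\sum_{\beta\in J_{r,n}}\left|(\mathbf{A}^{k+1})^{\beta}_{\beta}\right|,\qquad d_{ij}=\sum_{\beta\in J_{r,n}\{i\}}\left|\left(\mathbf{A}^{k+1}_{.\,i}(\mathbf{a}^{(k)}_{.j})\right)^{\beta}_{\beta}\right|\quad\text{for all } i,j=1,\dots,n.$$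
   Context: $\operatorname{Ind}\mathbf{A}$ is the least integer $k\ge0$ such that $\operatorname{rank}\mathbf{A}^{k+1}=\operatorname{rank}\mathbf{A}^{k}$ (with $\mathbf{A}^0=\mathbf{I}$). If $\operatorname{Ind}\mathbf{A}=k$, the Drazin inverse $\mathbf{A}^{D}$ is the unique matrix $\mathbf{X}$ with $\mathbf{A}^{k+1}\mathbf{X}=\mathbf{A}^{k}$, $\mathbf{X}\mathbf{A}\mathbf{X}=\mathbf{X}$, $\mathbf{A}\mathbf{X}=\mathbf{X}\mathbf{A}$. $\mathbf{a}^{(k)}_{.j}$ denotes the $j$th column of $\mathbf{A}^{k}$. $\mathbf{A}^{k+1}_{.\,i}(\mathbf{b})$ is the matrix obtained from $\mathbf{A}^{k+1}$ by replacing its $i$th column by the column vector $\mathbf{b}$. For $1\le r\le n$, $J_{r,n}$ is the set of all strictly increasing sequences of $r$ integers chosen from $\{1,\dots,n\}$, and $J_{r,n}\{i\}$ is the set of those $\beta\in J_{r,n}$ containing $i$. $|\mathbf{B}^{\beta}_{\beta}|$ denotes the principal minor of the square matrix $\mathbf{B}$ with rows and columns indexed by $\beta$. *)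

(* Defs.v *)
From mathcomp Require Export all_boot all_order all_algebra.
From mathcomp Require Export complex.
From mathcomp Require Export reals.

Set Implicit Arguments.
Unset Strict Implicit.
Unset Printing Implicit Defensive.

Import GRing.Theory.
Local Open Scope ring_scope.

Section Index.
Variables (F : fieldType) (n : nat).
Implicit Types A X Y : 'M[F]_n.

Lemma ex_mxindex A : exists k, \rank (A ^+ k.+1) == \rank (A ^+ k).
Proof.
suff H m k : (\rank (A ^+ k) <= m)%N ->
  exists k, \rank (A ^+ k.+1) == \rank (A ^+ k) by exact: (H _ 0%N (leqnn _)).
have le_rk j : (\rank (A ^+ j.+1) <= \rank (A ^+ j))%N.
  by rewrite exprS mxrankM_maxr.
elim: m k => [|m IHm] k rk_k; have := le_rk k; rewrite leq_eqVlt.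
  by case/predU1P=> [e|]; [exists k; apply/eqP | move/leq_trans=> /(_ _ rk_k)].
case/predU1P=> [e|lt_rk]; first by exists k; apply/eqP.
by apply: (IHm k.+1); rewrite -ltnS (leq_trans lt_rk).
Qed.

Definition mxindex A : nat := ex_minn (ex_mxindex A).

Lemma mxindexP A :
  \rank (A ^+ (mxindex A).+1) = \rank (A ^+ mxindex A) /\
  forall j, \rank (A ^+ j.+1) = \rank (A ^+ j) -> (mxindex A <= j)%N.
Proof.
rewrite /mxindex; case: ex_minnP => k /eqP rk_k min_k.
by split=> // j rk_j; apply: min_k; apply/eqP.
Qed.

Definition is_drazin A X : bool :=
  let k := mxindex A in
  [&& A ^+ k.+1 *m X == A ^+ k, X *m A *m X == X & A *m X == X *m A].

Lemma ex_drazin A : exists X, is_drazin A X.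
Proof.
have [rk_k _] := mxindexP A.
rewrite /is_drazin; set k := mxindex A in rk_k *.
have [Y defY] : exists Y, A ^+ k = Y * A ^+ k.+1.
  apply/submxP; have sub : (A ^+ k.+1 <= A ^+ k)%MS by rewrite exprS submxMl.
  by have := mxrank_leqif_sup sub; case=> _ <-; rewrite rk_k.
have [Z defZ] : exists Z, A ^+ k = A ^+ k.+1 * Z.
  have sub : ((A ^+ k.+1)^T <= (A ^+ k)^T)%MS.
    by rewrite exprSr trmx_mul submxMl.
  have /submxP[Z defZ] : ((A ^+ k)^T <= (A ^+ k.+1)^T)%MS.
    by have := mxrank_leqif_sup sub; case=> _ <-; rewrite !mxrank_tr rk_k.
  by exists Z^T; rewrite -[LHS]trmxK defZ trmx_mul trmxK.
have powY m : Y ^+ m * (A ^+ k * A ^+ m) = A ^+ k.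
  elim: m => [|m IHm]; first by rewrite mul1r mulr1.
  transitivity (Y ^+ m * (Y * A ^+ k.+1 * A ^+ m)); last by rewrite -defY.
  by rewrite exprSr (exprS A m) (exprSr A k) !mulrA.
have powZ m : A ^+ m * A ^+ k * Z ^+ m = A ^+ k.
  elim: m => [|m IHm]; first by rewrite mul1r mulr1.
  transitivity (A ^+ m * (A ^+ k.+1 * Z) * Z ^+ m); last by rewrite -defZ.
  by rewrite exprSr (exprS Z m) (exprS A k) !mulrA.
have YZ m : Y ^+ m * A ^+ k = A ^+ k * Z ^+ m.
  rewrite -[in LHS](powZ m) -[in RHS](powY m) !mulrA; congr (_ * _).
  by rewrite -!mulrA -!exprD addnC.
exists (Y ^+ k.+1 * A ^+ k); rewrite ?mulmxE.
have AX : A * (Y ^+ k.+1 * A ^+ k) = Y ^+ k * A ^+ k.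
  by rewrite !YZ mulrA -exprS [Z ^+ _]exprS mulrA -defZ.
have XA : Y ^+ k.+1 * A ^+ k * A = Y ^+ k * A ^+ k.
  by rewrite -mulrA -exprSr exprSr -mulrA -defY.
apply/and3P; split; apply/eqP; last by rewrite AX XA.
- by rewrite YZ mulrA powZ.
- by rewrite XA (YZ k.+1) mulrA -(mulrA (Y ^+ k)) powY.
Qed.

Definition drazin A : 'M[F]_n := xchoose (ex_drazin A).

Lemma drazinP A : is_drazin A (drazin A).
Proof. exact: xchooseP (ex_drazin A). Qed.

Lemma drazin_unique A X : is_drazin A X -> X = drazin A.
Proof.
have := drazinP A; move: (drazin A) => Y; rewrite /is_drazin.
set k := mxindex A.
case/and3P=> /eqP Yk /eqP YAY /eqP YA /and3P[/eqP Xk /eqP XAX /eqP XA].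
rewrite ?mulmxE /= in Yk YAY YA Xk XAX XA.
have main (U : 'M[F]_n) m : U * A * U = U -> A * U = U * A ->
    U = U ^+ m.+1 * A ^+ m /\ U = A ^+ m * U ^+ m.+1.
  move=> UAU UA; elim: m => [|m [e1 e2]]; first by rewrite mulr1 mul1r.
  have cUA j : GRing.comm U (A ^+ j) by apply: commrX.
  have e3 : U = U ^+ m.+2 * A ^+ m.+1.
    rewrite [U ^+ _]exprS [A ^+ _]exprSr mulrA -[U * _ * _]mulrA -e1.
    by rewrite -mulrA -UA mulrA.
  by split=> //; rewrite {1}e3; apply/commr_sym/commrX/commr_sym/commrX.
have [X1 _] := main X k XAX XA; have [_ Y2] := main Y k YAY YA.
have XAY1 : X * A * Y = X.
  rewrite {1 2}X1 -!mulrA (mulrA (A ^+ k)) -exprSr.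
  by rewrite [A ^+ k.+1 * Y]Yk.
have XAY2 : X * A * Y = Y.
  have XkL : X * A ^+ k.+1 = A ^+ k.
    have cXA : GRing.comm X (A ^+ k.+1) by apply: commrX.
    by rewrite cXA.
  by rewrite {2}Y2 {1}Y2 mulrA -[X * A * _]mulrA -exprS XkL.
by rewrite -XAY1 XAY2.
Qed.
End Index.

Section Minors.
Variables (F : fieldType) (n : nat).

(* J_{r,n}, with indices running over 0, ..., n - 1 *)
Definition incr_seqs (r : nat) : {set r.-tuple 'I_n} :=
  [set b : r.-tuple 'I_n | sorted ltn (map val b)].

(* J_{r,n}{i} *)
Definition incr_seqs_at (r : nat) (i : 'I_n) : {set r.-tuple 'I_n} :=
  [set b in incr_seqs r | i \in b].

Definition principal_minor (r : nat) (B : 'M[F]_n) (b : r.-tuple 'I_n) : F :=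
  \det (mxsub (tnth b) (tnth b) B).

Definition replace_col (B : 'M[F]_n) (i : 'I_n) (c : 'cV[F]_n) : 'M[F]_n :=
  \matrix_(p, q) if q == i then c p 0 else B p q.

Definition minor_sum (r : nat) (B : 'M[F]_n) : F :=
  \sum_(b in incr_seqs r) principal_minor B b.

(* the numerator d_{ij}, for k = Ind A and r = rank A^k *)
Definition drazin_num (k r : nat) (A : 'M[F]_n) (i j : 'I_n) : F :=
  \sum_(b in incr_seqs_at r i)
    principal_minor (replace_col (A ^+ k.+1) i (col j (A ^+ k))) b.
End Minors.

(* Main.v *)
From mathcomp Require Import all_fingroup.
Require Import Defs.

Set Implicit Arguments.
Unset Strict Implicit.
Unset Printing Implicit Defensive.

Import GRing.Theory.
Local Open Scope ring_scope.

(** Write [k] for the index of [A] and factor [A ^+ k = U *m V] through its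
    rank [r], with [U] left invertible and [V] right invertible.  Then
    [A ^+ k.+1 = U *m (V *m A)], and everything is governed by the [r] by [r]
    matrix [N = V *m A *m U].

    The Drazin inverse inverts [A] on the image of [A ^+ k] and vanishes on
    the kernel of [A ^+ k]; in terms of the factorization this makes [N]
    invertible ([drazin_core_unitmx]) and gives [drazin A = U *m N^-1 *m V]
    ([drazin_factor]).

    On the other side, the Cauchy-Binet formula identifies the sum of the
    principal [r]-minors of any product [U *m W] with [\det (W *m U)]
    ([minor_sum_mulmx]), so the denominator is [\det N], which is nonzero.  For
    the numerator, the sum over the index sets containing [i] is the sum over
    all index sets minus the same sum with column [i] replaced by zero.  Both
    matrices still factor through [U], and both [r] by [r] determinants are
    those of rank one perturbations of [N] by multiples of row [i] of [U]; the
    matrix determinant lemma evaluates their difference as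
    [\det N * (U *m N^-1 *m V) i j] ([sum_minors_at_cramer]). *)

(** * The Cauchy-Binet formula *)

Lemma incr_seqs_uniq n r (b : r.-tuple 'I_n) : b \in incr_seqs n r -> uniq b.
Proof.
rewrite inE => sb; rewrite -(map_inj_uniq val_inj).
by apply: sorted_uniq sb; [exact: ltn_trans | exact: ltnn].
Qed.

Definition sort_values n r (f : {ffun 'I_r -> 'I_n}) : r.-tuple 'I_n :=
  sort_tuple (relpre val leq) (mktuple f).

Lemma sort_values_incr n r (f : {ffun 'I_r -> 'I_n}) :
  injectiveb f -> sort_values f \in incr_seqs n r.
Proof.
move=> /injectiveP injf; rewrite inE ltn_sorted_uniq_leq.
rewrite (map_inj_uniq val_inj) sort_uniq sorted_map.
rewrite sort_sorted ?andbT; last by move=> x y; exact: leq_total.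
by rewrite map_inj_uniq ?enum_uniq.
Qed.

(** This lets a sum over injective functions be regrouped as a double sum over
    increasing sequences and permutations. *)
Lemma sort_values_eqP n r (f : {ffun 'I_r -> 'I_n}) (b : r.-tuple 'I_n) :
  b \in incr_seqs n r ->
  reflect (exists s : 'S_r, f = [ffun i => tnth b (s i)])
          (injectiveb f && (sort_values f == b)).
Proof.
move=> bP; apply: (iffP andP) => [[_ /eqP sfb]|[s ->]].
  have /tuple_permP[s fE] : perm_eq (mktuple f) b by rewrite -sfb perm_sym perm_sort.
  exists s; apply/ffunP=> i; rewrite ffunE -(tnth_mktuple f).
  have -> : mktuple f = [tuple tnth b (s j) | j < r] by apply: val_inj.
  by rewrite tnth_mktuple.
have injb : injective (fun i => tnth b (s i)).
  by move=> i j /(tuple_uniqP _ (incr_seqs_uniq bP)) /perm_inj.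
have injf : injectiveb [ffun i => tnth b (s i)].
  by apply/injectiveP=> i j; rewrite !ffunE; apply: injb.
split=> //; apply/eqP/val_inj/(inj_map val_inj) => /=.
have := sort_values_incr injf; rewrite inE => sf.
move: bP; rewrite inE => sb.
apply: (irr_sorted_eq ltn_trans ltnn sf sb) => x.
apply: perm_mem; apply: perm_map.
rewrite perm_sort; apply/tuple_permP; exists s.
by congr (tval _); apply: eq_from_tnth => i; rewrite !tnth_mktuple ffunE.
Qed.

(** Expanding every entry of [A *m B] turns [\det (A *m B)] into a sum over all
    functions [f] from row indices to the [n] summation indices.  A
    non-injective [f] contributes a determinant with two equal rows, hence
    zero; among the injective ones, those with the same sorted values [b]
    differ by a permutation of the rows of [rowsub (tnth b) B], and the
    resulting signs rebuild the determinant of [colsub (tnth b) A]. *)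
Lemma cauchy_binet (R : comNzRingType) n r (A : 'M[R]_(r, n)) (B : 'M[R]_(n, r)) :
  \det (A *m B) =
  \sum_(b in incr_seqs n r) \det (colsub (tnth b) A) * \det (rowsub (tnth b) B).
Proof.
transitivity (\sum_(f : {ffun 'I_r -> 'I_n})
    (\prod_i A i (f i)) * \det (rowsub f B)).
  transitivity (\sum_(f : {ffun 'I_r -> 'I_n}) \sum_(s : 'S_r)
      (-1) ^+ s * \prod_i (A i (f i) * B (f i) (s i))).
    rewrite exchange_big; apply: eq_bigr => /= s _; rewrite -big_distrr /=.
    rewrite -(bigA_distr_bigA (fun i j => A i j * B j (s i))) /=.
    by congr (_ * _); apply: eq_bigr => i _; rewrite mxE.
  apply: eq_bigr => f _; rewrite big_distrr /=; apply: eq_bigr => s _.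
  rewrite big_split mulrCA /=; congr (_ * (_ * _)).
  by apply: eq_bigr => i _; rewrite mxE.
rewrite (bigID (fun f : {ffun 'I_r -> 'I_n} => injectiveb f)) /= [X in _ + X]big1 ?addr0.
  rewrite (partition_big (@sort_values n r) (mem (incr_seqs n r))) /=; last first.
    exact: sort_values_incr.
  apply: eq_bigr => b bP.
  (* The fibre of sorting above b is parametrized by the permutations of b. *)
  pose perm_of_ffun (f : {ffun 'I_r -> 'I_n}) : 'S_r :=
    odflt 1%g [pick s : 'S_r | f == [ffun i => tnth b (s i)]].
  rewrite (reindex (fun s : 'S_r => [ffun i => tnth b (s i)])) /=; last first.
    exists perm_of_ffun => [s _|f /(sort_values_eqP _ bP)[s fE]]; rewrite /perm_of_ffun.
      case: pickP => [t /eqP/ffunP tE|/(_ s)]; last by rewrite eqxx.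
      apply/perm.permP=> i /=; have := tE i; rewrite !ffunE.
      by move/(tuple_uniqP _ (incr_seqs_uniq bP)).
    by case: pickP => [t /eqP <-|/(_ s)]; rewrite // fE eqxx.
  rewrite [RHS]big_distrl /=; apply: eq_big => s.
    by apply/(sort_values_eqP _ bP); exists s.
  move=> _.
  have -> : rowsub [ffun i => tnth b (s i)] B = row_perm s (rowsub (tnth b) B).
    by apply/matrixP=> i j; rewrite !mxE ffunE.
  rewrite row_permE det_mulmx det_perm mulrA; congr (_ * _).
  by rewrite mulrC; congr (_ * _); apply: eq_bigr => i _; rewrite mxE ffunE.
move=> f /injectivePn[i1 [i2 i12 fE]].
by rewrite (determinant_alternate i12) ?mulr0 // => j; rewrite !mxE fE.
Qed.

(** * Determinants of rank one perturbations *)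

(** The two products of [block_mx 1 X (- Y) 1] and [block_mx 1 0 Y 1] are both
    block upper triangular, and each side of the identity is the determinant
    of one of them. *)
Lemma det1D_mulmxC (R : comPzRingType) m p (X : 'M[R]_(m, p)) (Y : 'M[R]_(p, m)) :
  \det (1%:M + X *m Y) = \det (1%:M + Y *m X).
Proof.
have := det_mulmx (block_mx 1%:M X (- Y) 1%:M) (block_mx 1%:M 0 Y 1%:M).
rewrite mulrC -det_mulmx !mulmx_block !(mul1mx, mulmx1, mul0mx, mulmx0, add0r, addr0).
by rewrite addNr addrN !det_ublock !det1 mul1r mulr1 (addrC (Y *m X)).
Qed.

Lemma det_add_rank1 (R : comUnitRingType) r (N : 'M[R]_r) (c : 'cV_r) (u : 'rV_r) :
  N \in unitmx ->
  \det (N + c *m u) = \det N * (1 + (u *m invmx N *m c) 0 0).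
Proof.
move=> uN; have -> : N + c *m u = N *m (1%:M + invmx N *m c *m u).
  by rewrite mulmxDr mulmx1 !mulmxA mulmxV // mul1mx.
by rewrite det_mulmx det1D_mulmxC det_mx11 mxE mulmxA [1%:M 0 0]mxE.
Qed.

(** * Sums of principal minors of a product *)

Section MinorSums.
Variables (F : fieldType) (n r : nat).

Lemma minor_sum_mulmx (U : 'M[F]_(n, r)) (W : 'M[F]_(r, n)) :
  minor_sum r (U *m W) = \det (W *m U).
Proof.
rewrite cauchy_binet; apply: eq_bigr => b _.
by rewrite /principal_minor mxsub_mul det_mulmx mulrC.
Qed.

(** A minor that avoids [i] does not see column [i], while one that uses [i]
    vanishes when that column is zero; so subtracting the full sum for a zero
    column leaves exactly the minors that use [i]. *)
Lemma sum_minors_at_replace_col (B : 'M[F]_n) i (c : 'cV_n) :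
  \sum_(b in incr_seqs_at r i) principal_minor (replace_col B i c) b =
  minor_sum r (replace_col B i c) - minor_sum r (replace_col B i 0).
Proof.
rewrite /minor_sum -sumrB [RHS](bigID (fun b : r.-tuple 'I_n => i \in b)) /=.
rewrite [X in _ + X]big1 ?addr0 => [|b /andP[_ ib]].
  apply: eq_big => b; first by rewrite in_set.
  rewrite inE => /andP[_ /tnthP[q iq]].
  rewrite [X in _ - X](_ : _ = 0) ?subr0 //.
  rewrite /principal_minor (expand_det_col _ q) big1 // => p _.
  by rewrite !mxE -iq eqxx mul0r.
apply/eqP; rewrite subr_eq0; apply/eqP; rewrite /principal_minor; congr (\det _).
apply/matrixP=> p q; rewrite !mxE; case: eqP => // bq.
by rewrite -bq mem_tnth in ib.
Qed.

(** Replacing a column of [U *m W] by a vector in the image of [U] preserves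
    the factorization through [U] and perturbs [W] by a matrix of rank one. *)
Lemma replace_col_mulmx (U : 'M[F]_(n, r)) (W : 'M[F]_(r, n)) i (c : 'cV_r) :
  replace_col (U *m W) i (U *m c) =
  U *m (W + (c - col i W) *m delta_mx 0 i).
Proof.
apply/matrixP=> p q; rewrite mxE; case: eqP => [->|/eqP qi]; rewrite !mxE.
  apply: eq_bigr => s _; rewrite !mxE big_ord1 !mxE !eqxx mulr1.
  by rewrite addrC subrK.
apply: eq_bigr => s _; rewrite !mxE big_ord1 !mxE (negPf qi) andbF mulr0.
by rewrite addr0.
Qed.

(** A Cramer rule for a matrix [U *m W] that may be singular: it reads off the [i]-th coordinate of
    the vector [U *m (W *m U)^-1 *m c], which solves
    [U *m W *m x = U *m c], from minors of order [r]. *)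
Lemma sum_minors_at_cramer (U : 'M[F]_(n, r)) (W : 'M[F]_(r, n)) i (c : 'cV_r) :
  W *m U \in unitmx ->
  \sum_(b in incr_seqs_at r i)
     principal_minor (replace_col (U *m W) i (U *m c)) b =
  \det (W *m U) * (U *m invmx (W *m U) *m c) i 0.
Proof.
move=> uN; rewrite sum_minors_at_replace_col.
have -> : replace_col (U *m W) i 0 = replace_col (U *m W) i (U *m 0).
  by rewrite mulmx0.
rewrite !replace_col_mulmx !minor_sum_mulmx !(mulmxDl W) -!(mulmxA _ _ U) -!rowE.
rewrite !det_add_rank1 // -mulrBr; congr (_ * _).
(* The contributions of the old column i cancel in the difference. *)
rewrite opprD addrACA subrr add0r !mulmxBr mulmx0.
have -> : (U *m invmx (W *m U) *m c) i 0 = (row i U *m invmx (W *m U) *m c) 0 0.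
  by rewrite -!row_mul [RHS]mxE.
move: (_ *m c) (_ *m col i W) => P Q.
by rewrite !mxE sub0r opprK subrK.
Qed.
End MinorSums.

(** * The Drazin inverse through a rank factorization *)

Section DrazinFactor.
Variables (F : fieldType) (n : nat) (A : 'M[F]_n).

Let D := drazin A.
Let k := mxindex A.

Lemma drazin_comm : A * D = D * A.
Proof. by have /and3P[_ _ /eqP] := drazinP A. Qed.

Lemma drazin_mul_idem j : (D * A) ^+ j.+1 = D * A.
Proof.
have /and3P[_ /eqP DAD _] := drazinP A.
elim: j => [|j IHj]; first by rewrite expr1.
by rewrite exprS IHj mulrA -[LHS]/(D *m A *m D *m A) DAD.
Qed.

Lemma drazin_mul_exp : D * A * A ^+ k = A ^+ k.
Proof.
have /and3P[/eqP AkD _ _] := drazinP A.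
rewrite -mulrA -exprS -[RHS]AkD.
by apply: commrX; apply/esym/drazin_comm.
Qed.

Lemma drazin_expD : D ^+ k.+1 * A ^+ k = D.
Proof.
have /and3P[_ /eqP DAD _] := drazinP A.
have cDA : GRing.comm D A by apply/esym/drazin_comm.
case: k => [|j]; first by rewrite mulr1.
rewrite exprS -mulrA -exprMn_comm // drazin_mul_idem.
by rewrite -drazin_comm mulrA.
Qed.

Variables (r : nat) (U : 'M[F]_(n, r)) (V : 'M[F]_(r, n)).
Variables (L : 'M[F]_(r, n)) (R : 'M[F]_(n, r)).
Hypotheses (Ak : A ^+ k = U *m V) (LU : L *m U = 1%:M) (VR : V *m R = 1%:M).

(** [A ^+ k] is recovered from [A ^+ k * A * A ^+ k = U *m N *m V], where
    [N = V *m A *m U], by multiplying by a power of the Drazin inverse;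
    cancelling [U] and [V] exhibits a right inverse of [N]. *)
Lemma drazin_core_unitmx : V *m A *m U \in unitmx.
Proof.
have cDA : GRing.comm D A by apply/esym/drazin_comm.
have e : A ^+ k = A ^+ k * A * A ^+ k * D ^+ k.+1.
  rewrite -[LHS]drazin_mul_exp -(drazin_mul_idem k) exprMn_comm //.
  have cDk : GRing.comm (D ^+ k.+1) (A ^+ k.+1 * A ^+ k).
    by rewrite -exprD; apply/commrX/commr_sym/commrX/commr_sym.
  by rewrite -mulrA cDk (exprSr A).
have e2 : 1%:M = V *m A *m U *m (V *m D ^+ k.+1 *m R).
  have := congr1 (fun M => L *m M *m R) e.
  rewrite /= -!mulmxE Ak !mulmxA LU !mul1mx VR -!mulmxA => ->.
  by rewrite !mulmxA.
by case/esym/mulmx1_unit: e2.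
Qed.

(** Let [X] be the right-hand side.  [D *m A] fixes the image of [U], so
    [D *m A *m X = X]; and [A *m X] is absorbed by [A ^+ k], which is a right
    factor of [D], so [D *m A *m X = D] as well. *)
Lemma drazin_factor : D = U *m invmx (V *m A *m U) *m V.
Proof.
set N := V *m A *m U; set X := U *m _ *m V.
have uN : N \in unitmx := drazin_core_unitmx.
have DAU : D *m A *m U = U.
  rewrite -[RHS]mulmx1 -VR mulmxA -Ak -[in RHS]drazin_mul_exp -!mulmxE Ak.
  by rewrite -!mulmxA VR mulmx1.
have AkAX : A ^+ k *m A *m X = A ^+ k.
  rewrite Ak /X !mulmxA -(mulmxA U V A) -(mulmxA U _ U) -/N.
  by rewrite -(mulmxA U N) mulmxV // mulmx1.
transitivity (D *m A *m X); last by rewrite /X !mulmxA DAU.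
have DkAk : D ^+ k.+1 *m A ^+ k = D := drazin_expD.
by rewrite -[LHS]DkAk -{1}AkAX !mulmxA DkAk.
Qed.
End DrazinFactor.

Theorem theorem3p3 (R : realType) (n k r : nat) (A : 'M[R[i]%C]_n)
  (Ind_A : mxindex A = k)
  (rank_Ak1 : \rank (A ^+ k.+1) = r) (rank_Ak : \rank (A ^+ k) = r)
  (r_le_n : (r <= n)%N) (r_ge1 : (1 <= r)%N) :
  minor_sum r (A ^+ k.+1) != 0 /\
  drazin A = \matrix_(i < n, j < n)
    (drazin_num k r A i j / minor_sum r (A ^+ k.+1)).
Proof.
subst k; set k := mxindex A in rank_Ak *.
have [U [V [Ak fU fV]]] : exists (U : 'M_(n, r)) (V : 'M_(r, n)),
    [/\ A ^+ k = U *m V, row_full U & row_free V].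
  rewrite -rank_Ak; exists (col_base (A ^+ k)), (row_base (A ^+ k)).
  by split; rewrite ?mulmx_base ?col_base_full ?row_base_free.
have [L LU] := row_fullP fU; have [Y VY] := row_freeP fV.
have Ak1 : A ^+ k.+1 = U *m (V *m A) by rewrite exprSr Ak mulmxA.
have uN := drazin_core_unitmx Ak LU VY.
have dN : minor_sum r (A ^+ k.+1) = \det (V *m A *m U).
  by rewrite Ak1 minor_sum_mulmx.
have nz_dN : minor_sum r (A ^+ k.+1) != 0 by rewrite dN -unitfE -unitmxE.
split=> //; apply/matrixP=> i j; rewrite (drazin_factor Ak LU VY) [RHS]mxE.
have -> : drazin_num k r A i j =
    minor_sum r (A ^+ k.+1) * (U *m invmx (V *m A *m U) *m V) i j.
  have colUV : col j (U *m V) = U *m col j V by rewrite !colE mulmxA.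
  rewrite dN /drazin_num Ak colUV Ak1.
  rewrite sum_minors_at_cramer //; congr (_ * _).
  by rewrite colE mulmxA -colE mxE.
by rewrite mulrC mulKf.
Qed.
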